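(* Let $\mathcal{M}$ be an image-finite concurrent game model, $q$ a state of $\mathcal{M}$ and $\varphi$ an ATL-formula. Then $\mathcal{M},q\models^g_f\varphi$ if and only if $\mathcal{M},q\models^g_b\varphi$.
   Context: A concurrent game model (CGM) is $\mathcal{M}=(\mathrm{Agt},\mathrm{St},\Pi,\mathrm{Act},d,o,v)$: $\mathrm{Agt}=\{1,\dots,k\}$ agents; nonempty sets $\mathrm{St}$ (states), $\Pi$ (proposition symbols), $\mathrm{Act}$ (actions); $d:\mathrm{Agt}\times\mathrm{St}\to\mathcal{P}(\mathrm{Act})\setminus\{\emptyset\}$; $o$ assigns to each state $q$ and each action profile $(\alpha_1,\dots,\alpha_k)$ with $\alpha_i\in d(i,q)$ an outcome state; $v:\Pi\to\mathcal{P}(\mathrm{St})$. $\mathcal{M}$ is image-finite if for every state $q$ the set $\{o(q,\vec\alpha)\mid\vec\alpha\text{ an action profile at }q\}$ is finite. For $A\subseteq\mathrm{Agt}$, $\overline{A}=\mathrm{Agt}\setminus A$ and $\mathrm{action}(A,q)$ is the set of tuples $(\alpha_i)_{i\in A}$ with $\alpha_i\in d(i,q)$. ATL formulae: $\varphi::=p\mid\neg\varphi\mid(\varphi\vee\varphi)\mid\langle\!\langle A\rangle\!\rangle\mathsf{X}\varphi\mid\langle\!\langle A\rangle\!\rangle\varphi\,\mathsf{U}\,\varphi\mid\langle\!\langle A\rangle\!\rangle\varphi\,\mathsf{R}\,\varphi$. Players: Eloise $\mathbf{E}$, Abelard $\mathbf{A}$; $\overline{\mathbf{P}}$ is the opponent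 of $\mathbf{P}$. One step game $\mathrm{step}(\mathbf{P},A,q)$: $\mathbf{P}$ picks a tuple in $\mathrm{action}(A,q)$, then $\overline{\mathbf{P}}$ picks a tuple in $\mathrm{action}(\overline{A},q)$; the resulting state is the outcome of the combined profile. $\Gamma$-bounded evaluation game $\mathcal{G}(\mathcal{M},q_{in},\varphi,\Gamma)$ ($\Gamma$ an ordinal): positions $(\mathbf{P},q,\psi)$ with $\psi$ a subformula of $\varphi$; start $(\mathbf{E},q_{in},\varphi)$. At $(\mathbf{P},q,p)$ the game ends, $\mathbf{P}$ wins iff $q\in v(p)$, else $\overline{\mathbf{P}}$ wins. $(\mathbf{P},q,\neg\psi)\to(\overline{\mathbf{P}},q,\psi)$. At $(\mathbf{P},q,\psi\vee\theta)$, $\mathbf{P}$ chooses $(\mathbf{P},q,\psi)$ or $(\mathbf{P},q,\theta)$. At $(\mathbf{P},q,\langle\!\langle A\rangle\!\rangle\mathsf{X}\psi)$, $\mathrm{step}(\mathbf{P},A,q)$ gives $q'$, next $(\mathbf{P},q',\psi)$. At $(\mathbf{P},q,\langle\!\langle A\rangle\!\rangle\psi\mathsf{U}\theta)$ the embedded game $\mathbf{g}(\mathbf{P},\mathbf{P},A,q,\theta,\psi)$ is played; at $(\mathbf{P},q,\langle\!\langle A\rangle\!\rangle\psi\mathsf{R}\theta)$ the embedded game $\mathbf{g}(\mathbf{P},\overline{\mathbf{P}},A,q,\theta,\psi)$. In an embedded game $\mathbf{g}(\mathbf{V},\mathbf{C},A,q_0,\psi_{\mathbf{C}},\psi_{\overline{\mathbf{C}}})$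 (verifier $\mathbf{V}$, controller $\mathbf{C}$), $\mathbf{C}$ first chooses an ordinal $\gamma_0<\Gamma$; play goes through configurations $(\gamma,q)$ from $(\gamma_0,q_0)$ with rules in order: (i) if $\gamma=0$ end at exit position $(\mathbf{V},q,\psi_{\mathbf{C}})$; (ii) $\mathbf{C}$ may end at $(\mathbf{V},q,\psi_{\mathbf{C}})$; (iii) $\overline{\mathbf{C}}$ may end at $(\mathbf{V},q,\psi_{\overline{\mathbf{C}}})$; (iv) otherwise $\mathrm{step}(\mathbf{V},A,q)$ gives $q'$, continue from $(\gamma',q')$ with $\gamma'=\gamma-1$ if $\gamma$ is a successor and $\gamma'<\gamma$ chosen by $\mathbf{C}$ if $\gamma$ is a limit. The evaluation game continues from the exit position. Strategies: a player's strategy specifies disjunct choices, tuples of actions (as verifier) or response functions $\mathrm{action}(A,q)\to\mathrm{action}(\overline{A},q)$ (as falsifier) in one step games, and at until/release positions: for the controller, an ordinal $\gamma_0<\Gamma$, a timer $t$ (with $t(\gamma,q)<\gamma$ for limit $\gamma$, giving the new time limit when the limit is $\gamma$ and the new state is $q$) and an embedded strategy depending on configurations $(\gamma,q)$ (giving ''end the game'' as permitted by the role, or an action tuple / response function); for the non-controller, for each $\gamma_0<\Gamma$ such a configuration-dependent embedded strategy. A winning strategy wins all plays consistent with it. $\mathcal{M},q\models^g_b\varphi$ iff $\mathbf{E}$ has a winning strategy in $\mathcal{G}(\mathcal{M},q,\varphi,2^\kappa)$, where $\kappa$ is the cardinality of $\mathcal{M}$; $\mathcal{M},q\models^g_f\varphi$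 iff $\mathbf{E}$ has a winning strategy in $\mathcal{G}(\mathcal{M},q,\varphi,\omega)$. *)

(* Defs.v *)
From mathcomp Require Import all_boot.
From mathcomp Require Import boolp classical_sets functions cardinality wochoice.
From Stdlib Require Import Relation_Operators Wellfounded.Inverse_Image.
Set Implicit Arguments.
Unset Strict Implicit.
Unset Printing Implicit Defensive.

Local Open Scope classical_set_scope.
Local Open Scope card_scope.

(* An ordinal Gamma is presented by a well-ordered type, whose elements stand
   for the ordinals gamma < Gamma. *)
Record ordinal_type := OrdinalType {
  ord_sort :> Type;
  olt : ord_sort -> ord_sort -> Prop;
  olt_trans : forall x y z, olt x y -> olt y z -> olt x z;
  olt_total : forall x y, olt x y \/ x = y \/ olt y x;
  olt_wf : well_founded olt
}.

Definition is_zero (G : ordinal_type) (g : G) : Prop := forall g', ~ olt g' g.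

(* g = g' + 1 *)
Definition is_succ_of (G : ordinal_type) (g' g : G) : Prop :=
  olt g' g /\ forall h, ~ (olt g' h /\ olt h g).

Definition is_limit (G : ordinal_type) (g : G) : Prop :=
  ~ is_zero g /\ ~ exists g', is_succ_of g' g.

Lemma ltn_trans_Prop (x y z : nat) : x < y -> y < z -> x < z.
Proof. exact: ltn_trans. Qed.

Lemma ltn_total_Prop (x y : nat) : x < y \/ x = y \/ y < x.
Proof. by case: (ltngtP x y); auto. Qed.

Lemma ltn_wf : well_founded (fun x y : nat => x < y).
Proof.
by elim/ltn_ind=> n IH; constructor.
Qed.

Definition omega : ordinal_type :=
  OrdinalType ltn_trans_Prop ltn_total_Prop ltn_wf.

(* G is the cardinal of T, i.e. the initial ordinal equinumerous with T. *)
Definition is_cardinal_of (G : ordinal_type) (T : Type) : Prop :=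
  [set: G] #= [set: T] /\
  forall g : G, ~ ([set: T] #<= [set g' : G | olt g' g]).

Lemma well_order_ordinal (T : Type) :
  exists G : ordinal_type, [set: G] #= [set: T].
Proof.
have [R wR] := well_ordering_principle {classic T}.
have [R_refl R_anti] : reflexive R /\ antisymmetric R.
  by split; [move=> x; have := @wo_chain_reflexive _ R predT (withinW wR) x isT
            | move=> x y; apply: (@wo_chain_antisymmetric _ R predT (withinW wR))].
have R_tot : total R.
  by move=> x y; apply: (@wo_chainW _ R predT (withinW wR)).
pose lt (x y : {classic T}) : Prop := R x y /\ x <> y.
have lt_wf : well_founded lt.
  move=> x; apply: contrapT => nx.
  have [|z [[/asboolP nz zmin] _]] := wR [pred y | `[< ~ Acc lt y >]].
    by exists x; apply/asboolP.
  apply: nz; constructor=> y [Ryz yz]; apply: contrapT => ny.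
  by apply: yz; apply: R_anti; rewrite Ryz zmin //; apply/asboolP.
have lt_total x y : lt x y \/ x = y \/ lt y x.
  have [->|xy] := pselect (x = y); first by right; left.
  case/orP: (R_tot x y) => Rxy; [left|right; right]; split => //.
  by move=> /esym.
have lt_trans x y z : lt x y -> lt y z -> lt x z.
  move=> xy yz; have [//|[xz|zx]] := lt_total x z.
    subst z; case: xy => Rxy nxy; case: yz => Ryx _.
    by case: nxy; apply: R_anti; rewrite Rxy Ryx.
  exfalso; elim/(well_founded_ind lt_wf): x y z xy yz zx => x IH y z xy yz zx.
  exact: (IH z zx x y zx xy yz).
by exists (OrdinalType lt_trans lt_total lt_wf); exact: card_eqxx.
Qed.

Lemma cardinal_exists (T : Type) : exists G, is_cardinal_of G T.
Proof.
have [G GT] := well_order_ordinal T.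
have [ini|] := pselect (forall g : G, ~ ([set: T] #<= [set g' | olt g' g])).
  by exists G.
move=> /existsNP[g0 /contrapT Tg0].
elim/(well_founded_ind (@olt_wf G)): g0 Tg0 => g IH Tg.
have [[h [hg Th]]|nh] :=
  pselect (exists h, olt h g /\ [set: T] #<= [set g' | olt g' h]).
  exact: IH hg Th.
have sval_inj' : injective (sval : {x : G | olt x g} -> G).
  by move=> [x xg] [y yg] /= xy; exact: eq_exist.
pose W := {x : G | olt x g}; pose ltW (x y : W) := olt (sval x) (sval y).
have ltW_total x y : ltW x y \/ x = y \/ ltW y x.
  have [|[xy|]] := olt_total (sval x) (sval y); [by left| |by right; right].
  by right; left; exact: sval_inj'.
have ltW_wf : well_founded ltW by exact: wf_inverse_image (@olt_wf G).
have ltW_trans x y z : ltW x y -> ltW y z -> ltW x z by exact: olt_trans.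
have W_le (A : set W) (B : set G) : (forall x, A x -> B (sval x)) -> A #<= B.
  move=> AB; apply: (@card_le_trans _ _ _ (sval @` A)).
    by case/card_eqPle: (inj_card_eq (in2W sval_inj') : sval @` A #= A).
  by apply: subset_card_le => _ [x Ax <-]; exact: AB.
exists (OrdinalType ltW_trans ltW_total ltW_wf); split.
  apply/card_eqPle; split.
    apply: card_le_trans (_ : [set: G] #<= _); first exact: W_le.
    by case/card_eqPle: GT.
  apply: card_le_trans Tg _.
  have -> : [set g' | olt g' g] = sval @` [set: W].
    apply/seteqP; split=> [x xg|_ [[x xg] _ <-] //].
    by exists (exist _ x xg).
  exact: card_image_le.
move=> /= [h hg] Th; apply: nh; exists h; split => //.
by apply: card_le_trans Th _; exact: W_le.
Qed.

Definition cardinal (T : Type) : ordinal_type := sval (cid (cardinal_exists T)).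

(* Agt = 'I_num_agents; an action profile at q is a function sending each
   agent i to an element of d(i, q), and o is defined on these only. *)
Record cgm := CGM {
  num_agents : nat;
  state : Type;
  symbol : Type;
  act : Type;
  state_nonempty : inhabited state;
  symbol_nonempty : inhabited symbol;
  act_nonempty : inhabited act;
  avail : 'I_num_agents -> state -> set act;
  avail_nonempty : forall i q, avail i q !=set0;
  outcome : forall q : state,
    (forall i : 'I_num_agents, {a : act | avail i q a}) -> state;
  valuation : symbol -> set state
}.

Definition profile (M : cgm) (q : state M) : Type :=
  forall i : 'I_(num_agents M), {a : act M | avail i q a}.

Definition image_finite (M : cgm) : Prop :=
  forall q : state M, finite_set [set outcome a | a in [set: profile q]].

Inductive atl (k : nat) (Pi : Type) : Type :=
| Symb of Pi
| Neg of atl k Pi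
| Or of atl k Pi & atl k Pi
| Next of {set 'I_k} & atl k Pi
| Until of {set 'I_k} & atl k Pi & atl k Pi      (* <<A>> psi U theta *)
| Release of {set 'I_k} & atl k Pi & atl k Pi.   (* <<A>> psi R theta *)

Definition formula (M : cgm) : Type := atl (num_agents M) (symbol M).

(* action(A, q) *)
Definition action (M : cgm) (A : {set 'I_(num_agents M)}) (q : state M) : Type :=
  forall i : 'I_(num_agents M), i \in A -> {a : act M | avail i q a}.

Lemma notin_in_setC (T : finType) (A : {set T}) (i : T) :
  ~ (i \in A) -> i \in (~: A)%SET.
Proof. by rewrite finset.in_setC => /negP. Qed.

Definition combine (M : cgm) (A : {set 'I_(num_agents M)}) (q : state M)
    (a : action A q) (b : action (~: A)%SET q) : profile q :=
  fun i => match @idP (i \in A) with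
           | ReflectT inA => a i inA
           | ReflectF ninA => b i (notin_in_setC ninA)
           end.

Variant player := Eloise | Abelard.

Definition opp (P : player) : player :=
  match P with Eloise => Abelard | Abelard => Eloise end.

Definition same (P Q : player) : bool :=
  match P, Q with
  | Eloise, Eloise | Abelard, Abelard => true
  | _, _ => false
  end.

Section OneStep.
Variables (M : cgm) (A : {set 'I_(num_agents M)}).

(* What a strategy prescribes in step(V, A, q): a tuple for A if the player is
   the verifier V (isV = true), a response function otherwise. *)
Definition step_choice (isV : bool) (q : state M) : Type :=
  if isV then action A q else action A q -> action (~: A)%SET q.

Definition step_outcome (isV : bool) (q : state M) :
    step_choice isV q -> set (state M) :=
  match isV with
  | true => fun a => [set q' | exists b, q' = outcome (combine a b)]
  | false => fun f => [set q' | exists a, q' = outcome (combine a (f a))]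
  end.

End OneStep.

(* The embedded game g(V, C, A, q0, psi_C, psi_notC) with bound G, from the
   viewpoint of one player: isV and isC tell whether that player is the
   verifier, resp. the controller. *)
Section Embedded.
Variables (M : cgm) (G : ordinal_type) (A : {set 'I_(num_agents M)}).
Variables isV isC : bool.

(* The prescription at each configuration (gamma, q); None = end the game. *)
Definition config_strategy : Type :=
  G -> forall q : state M, option (step_choice A isV q).

Record controller_strategy := ControllerStrategy {
  initial_limit : G;
  timer : G -> state M -> G;
  timer_lt : forall g q, is_limit g -> olt (timer g q) g;
  controller_config : config_strategy
}.

Definition embedded_strategy : Type :=
  if isC then controller_strategy else G -> config_strategy.

End Embedded.

Section EmbeddedPlay.
Variables (M : cgm) (G : ordinal_type) (A : {set 'I_(num_agents M)}).
Variables isV isC : bool.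

Definition possible_initial_limit : embedded_strategy G A isV isC -> set G :=
  match isC with
  | true => fun s => [set initial_limit s]
  | false => fun _ => [set: G]
  end.

Definition config_choice :
    embedded_strategy G A isV isC -> G -> config_strategy G A isV :=
  match isC with
  | true => fun s _ => controller_config s
  | false => fun s => s
  end.

Definition possible_limit_choice :
    embedded_strategy G A isV isC -> G -> state M -> set G :=
  match isC with
  | true => fun s g q' => [set timer s g q']
  | false => fun _ g _ => [set g' | olt g' g]
  end.

Variables (s : embedded_strategy G A isV isC) (g0 : G).

Definition possible_next_limit (g : G) (q' : state M) (g' : G) : Prop :=
  is_succ_of g' g \/ (is_limit g /\ possible_limit_choice s g q' g').

(* The moves between configurations that are consistent with s, the initial
   time limit being g0. *)
Inductive config_move : G * state M -> G * state M -> Prop :=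
| ConfigStep g q x q' g' :
    ~ is_zero g -> config_choice s g0 g q = Some x ->
    step_outcome x q' -> possible_next_limit g q' g' ->
    config_move (g, q) (g', q').

(* config_exit (g, q) b: a play consistent with s may end in configuration
   (g, q), at the exit position for psi_C if b = true and at the one for the
   other formula if b = false. The controller decides first on ending, so the
   opponent of a controller can end only if the controller does not. *)
Inductive config_exit : G * state M -> bool -> Prop :=
| ExitZero g q : is_zero g -> config_exit (g, q) true
| ExitSelf g q :
    ~ is_zero g -> config_choice s g0 g q = None -> config_exit (g, q) isC
| ExitOpp g q :
    ~ is_zero g -> (isC -> config_choice s g0 g q <> None) ->
    config_exit (g, q) (~~ isC).

End EmbeddedPlay.

(* The pairs (q, b) such that some play consistent with s of the embedded game
   started at q0 ends in state q, with b as in config_exit. *)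
Definition embedded_exit (M : cgm) (G : ordinal_type)
    (A : {set 'I_(num_agents M)}) (isV isC : bool)
    (s : embedded_strategy G A isV isC) (q0 : state M) : set (state M * bool) :=
  [set e | exists2 g0, possible_initial_limit s g0 &
     exists2 g, clos_refl_trans _ (config_move s g0) (g0, q0) (g, e.1) &
       config_exit s g0 (g, e.1) e.2].

Section Evaluation.
Variables (M : cgm) (G : ordinal_type).

Record position := Position {
  pos_player : player;
  pos_state : state M;
  pos_formula : formula M
}.

(* What a strategy of P prescribes at a position. The embedded game is
   g(Q, Q, A, q, theta, psi) for until and g(Q, opp Q, A, q, theta, psi) for
   release. *)
Definition choice_at (P : player) (pos : position) : Type :=
  let: Position Q q phi := pos in
  match phi with
  | Symb _ | Neg _ => unit
  | Or _ _ => if same P Q then bool else unit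
  | Next A _ => step_choice A (same P Q) q
  | Until A _ _ => embedded_strategy G A (same P Q) (same P Q)
  | Release A _ _ => embedded_strategy G A (same P Q) (same P (opp Q))
  end.

(* Positions are not restricted to subformulas of the evaluated formula; the
   prescriptions at other positions are never used. *)
Definition strategy (P : player) : Type := forall pos, choice_at P pos.

Definition or_outcome (b : bool) (psi theta : formula M) :
    (if b then bool else unit) -> set (formula M) :=
  match b with
  | true => fun c => [set if c then psi else theta]
  | false => fun _ => [set psi; theta]
  end.

Definition next_positions (P : player) (pos : position) :
    choice_at P pos -> set position :=
  match pos with
  | Position Q q phi =>
    match phi return choice_at P (Position Q q phi) -> set position with
    | Symb _ => fun _ => set0
    | Neg psi => fun _ => [set Position (opp Q) q psi]
    | Or psi theta => fun c =>
        [set Position Q q chi | chi in or_outcome psi theta c]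
    | Next A psi => fun c =>
        [set Position Q q' psi | q' in step_outcome c]
    | Until A psi theta => fun s =>
        [set Position Q e.1 (if e.2 then theta else psi)
          | e in embedded_exit s q]
    | Release A psi theta => fun s =>
        [set Position Q e.1 (if e.2 then theta else psi)
          | e in embedded_exit s q]
    end
  end.

Definition wins_at (P Q : player) (q : state M) (p : symbol M) : Prop :=
  if same P Q then valuation p q else ~ valuation p q.

(* Every play is finite: formulas get smaller along the evaluation game and
   time limits along an embedded game; and it ends at a position (Q, q, p). *)
Definition winning (P : player) (sigma : strategy P) (start : position) : Prop :=
  forall Q q p,
    clos_refl_trans _ (fun x y => next_positions (sigma x) y)
      start (Position Q q (Symb _ p)) ->
    wins_at P Q q p.

Definition Eloise_wins (q : state M) (phi : formula M) : Prop :=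
  exists sigma : strategy Eloise, winning sigma (Position Eloise q phi).

End Evaluation.

(* 2^kappa, where kappa is the cardinality of the set of states, is cardinal
   exponentiation. *)
Definition sat_bounded (M : cgm) (q : state M) (phi : formula M) : Prop :=
  Eloise_wins (cardinal (set (state M))) q phi.

Definition sat_finite (M : cgm) (q : state M) (phi : formula M) : Prop :=
  Eloise_wins omega q phi.

(* Main.v *)
Require Import Defs.
From mathcomp Require Import all_boot.
From mathcomp Require Import boolp classical_sets functions cardinality.
From Stdlib Require Import Relation_Operators.

(** Compositionally, an embedded game is described by the iterates [T n] of one
    monotone operator on sets of states: the controller wins from the union of
    the [T n], the non-controller from their intersection. Image-finiteness
    makes this union (intersection) a fixed point, so time limits beyond the
    finite ones help nobody. Conversely, if stage [n] is still needed then
    [T 0], ..., [T n] are pairwise distinct sets of states, so that the ordinal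
    2^kappa has more than [n] elements and contains the time limit [n]. *)

Set Implicit Arguments.
Unset Strict Implicit.
Unset Printing Implicit Defensive.

Local Open Scope classical_set_scope.

(** * Finite ordinals inside a well-ordered type *)

Section FiniteOrdinals.
Variable G : ordinal_type.

(** A relation rather than a map from [nat]: [G] may have too few elements for the ordinal [n] to
    exist in it. *)
Inductive is_nat : nat -> G -> Prop :=
| IsNat0 g : is_zero g -> is_nat 0 g
| IsNatS n g g' : is_nat n g -> is_succ_of g g' -> is_nat n.+1 g'.

Lemma ord_least (P : G -> Prop) g :
  P g -> exists2 m, P m & forall h, P h -> ~ olt h m.
Proof.
elim/(well_founded_ind (@olt_wf G)): g => g IH Pg.
have [[h [Ph hg]]|nh] := pselect (exists h, P h /\ olt h g); first exact: IH hg Ph.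
by exists g => // h Ph hg; apply: nh; exists h.
Qed.

Lemma succ_exists (g h : G) : olt g h -> exists2 g', is_succ_of g g' & ~ olt h g'.
Proof.
move=> gh; have [m gm mmin] := ord_least (P := olt g) gh.
by exists m; [split=> // k [gk]; exact: mmin | exact: mmin].
Qed.

Lemma is_zero_inj (g h : G) : is_zero g -> is_zero h -> g = h.
Proof.
by move=> g0 h0; have [/h0|[|/g0]] := olt_total g h.
Qed.

Lemma is_succ_of_inj (g h h' : G) : is_succ_of g h -> is_succ_of g h' -> h = h'.
Proof.
move=> [gh nh] [gh' nh']; have [hh'|[//|h'h]] := olt_total h h'.
  by case: (nh' h).
by case: (nh h').
Qed.

Lemma is_succ_of_fun (g g' h : G) : is_succ_of g h -> is_succ_of g' h -> g = g'.
Proof.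
move=> [gh ng] [gh' ng']; have [gg'|[//|g'g]] := olt_total g g'.
  by case: (ng g').
by case: (ng' g).
Qed.

Lemma is_nat_inj n (g h : G) : is_nat n g -> is_nat n h -> g = h.
Proof.
elim: n g h => [|n IH] g h ng nh;
  inversion ng as [? g0|? g1 ? ng1 sg]; inversion nh as [? h0|? h1 ? nh1 sh]; subst.
  exact: is_zero_inj.
by move: sg sh; rewrite (IH _ _ ng1 nh1); exact: is_succ_of_inj.
Qed.

(** Induction on [n]: as long as the current finite ordinal is strictly below [g] it has a
    successor, which is still not above [g]. *)
Lemma is_nat_or_lt (n : nat) (g : G) :
  (exists2 h, is_nat n h & ~ olt g h) \/ (exists2 j, j < n & is_nat j g).
Proof.
elim: n => [|n [[h nh gh]|[j jn ng]]].
- have [m _ mmin] := ord_least (P := xpredT) (g := g) isT.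
  by left; exists m; [constructor=> h; exact: mmin | exact: mmin].
- have [//|[hg|hg]] := olt_total g h.
    by right; exists n => //; rewrite hg.
  have [k hk gk] := succ_exists hg.
  by left; exists k => //; exact: IsNatS hk.
- by right; exists j => //; exact: ltnW.
Qed.

(** Pigeonhole: if [G] did not contain the ordinal [n], the [n.+1] values of [f] would all be among
    the ordinals smaller than [n]. *)
Lemma is_nat_exists (n : nat) (f : 'I_n.+1 -> G) :
  injective f -> exists g, is_nat n g.
Proof.
move=> finj; apply: contrapT => nn.
have /choice[r rP] : forall i, exists j : 'I_n, is_nat j (f i).
  move=> i; case: (is_nat_or_lt n (f i)) => [[h nh _]|[j jn nj]].
    by case: nn; exists h.
  by exists (Ordinal jn).
have rinj : injective r.
  move=> i j rij; apply: finj; have ri := rP i; rewrite rij in ri.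
  exact: is_nat_inj ri (rP j).
by have := leq_card _ rinj; rewrite !card_ord ltnn.
Qed.

Lemma nonzero_cases (g : G) :
  ~ is_zero g -> (exists g', is_succ_of g' g) \/ is_limit g.
Proof.
move=> ng; have [sg|nsg] := pselect (exists g', is_succ_of g' g); first by left.
by right.
Qed.

(** Strategies of a controller carry a timer even when play never meets a limit ordinal. *)
Lemma default_timer (T : Type) :
  G -> exists t : G -> T -> G, forall g q, is_limit g -> olt (t g q) g.
Proof.
move=> g0; have /choice[t tP] : forall g : G, exists g', is_limit g -> olt g' g.
  move=> g; have [lg|nlg] := pselect (is_limit g); last by exists g0.
  case: lg => /existsNP[g' /contrapT g'g] _.
  by exists g'.
by exists (fun g _ => t g) => g q; exact: tP.
Qed.

End FiniteOrdinals.

(** * The naturals in [omega]; stabilisation of iterates and chains *)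

Lemma is_nat_omega (n : nat) : is_nat n (n : omega).
Proof.
elim: n => [|n IH]; first by constructor=> h; rewrite /= ltn0.
apply: IsNatS IH _; split=> /=; first exact: ltnSn.
by move=> h [nh]; rewrite ltnS leqNgt nh.
Qed.

(** A repetition at [i < j <= n] freezes the sequence from [i] on, so term [n] would equal term
    [n.-1]. The condition on [m] is vacuous for [n = 0]. *)
Lemma iter_inj_before (T : Type) (f : T -> T) (x : T) (n : nat) :
  (forall i j, i < j -> iter i f x = iter j f x -> iter i.+1 f x = iter i f x) ->
  (forall m, m.+1 = n -> iter n f x <> iter m f x) ->
  injective (fun i : 'I_n.+1 => iter i f x).
Proof.
move=> stab new.
have key i j : i < j -> j <= n -> iter i f x <> iter j f x.
  move=> ij jn eij; have fix_i := stab _ _ ij eij.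
  have all_i k : iter (k + i) f x = iter i f x.
    by elim: k => // k IH; rewrite addSn iterS IH -iterS.
  have n0 : 0 < n by exact: leq_ltn_trans (leq0n i) (leq_trans ij jn).
  have i_n1 : i <= n.-1 by rewrite -ltnS prednK //; exact: leq_trans ij jn.
  apply: (new n.-1); first by rewrite prednK.
  by rewrite -(subnK i_n1) all_i -(subnK (leq_trans (ltnW ij) jn)) all_i.
move=> i j /= eij; apply/val_inj/eqP; apply/negPn/negP; rewrite neq_ltn.
case/orP=> lt_ij; first exact: key lt_ij (ltn_ord j : j <= n) eij.
exact: key lt_ij (ltn_ord i : i <= n) (esym eij).
Qed.

(** Each point that enters the chain has an index of entry; the maximum of these over the finite set
    [F] serves for all. *)
Lemma finite_chain_bound (T : Type) (F : set T) (Z : nat -> set T) :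
  finite_set F -> (forall i j, i <= j -> Z i `<=` Z j) ->
  exists n, forall q, F q -> (exists i, Z i q) -> Z n q.
Proof.
move=> finF Zmono.
have /choice[m mP] : forall q, exists i, (exists j, Z j q) -> Z i q.
  by move=> q; have [[i Ziq]|nZ] := pselect (exists j, Z j q); [exists i|exists 0].
have /finite_seqP[s sE] := finite_image m finF.
exists (\max_(i <- s) i) => q Fq /mP; apply: Zmono; apply: leq_bigmax_seq => //.
have : (m @` F) (m q) by exists q.
by rewrite sE.
Qed.

(** * Stages of an embedded game *)

Section Approximants.
Variables (M : cgm) (A : {set 'I_(num_agents M)}) (isV isC : bool).
Variables X Y : set (state M).

Definition pre (Z : set (state M)) : set (state M) :=
  [set q | exists x : step_choice A isV q, step_outcome x `<=` Z].

(** [X] and [Y] are the states where the exit for psi_C, resp. the other exit, is good for the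
    player. A controller may exit into [X], but before a step must tolerate the opponent's exit into
    [Y]; for a non-controller the two exits swap roles. *)
Definition approx_step (Z : set (state M)) : set (state M) :=
  if isC then X `|` (Y `&` pre Z) else X `&` (Y `|` pre Z).

(** The states won with time limit [n]; the start is [X] because limit 0 forces the exit for
    psi_C. *)
Definition approx (n : nat) : set (state M) := iter n approx_step X.

Lemma pre_mono Z Z' : Z `<=` Z' -> pre Z `<=` pre Z'.
Proof. by move=> ZZ' q [x xZ]; exists x => q' /xZ /ZZ'. Qed.

Lemma approx_step_mono Z Z' : Z `<=` Z' -> approx_step Z `<=` approx_step Z'.
Proof.
move=> ZZ'; rewrite /approx_step; case: isC.
  by apply: setUS; apply: setIS; exact: pre_mono.
by apply: setIS; apply: setUS; exact: pre_mono.
Qed.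

Lemma approx_mono i j : i <= j ->
  if isC then approx i `<=` approx j else approx j `<=` approx i.
Proof.
have stepP n : if isC then approx n `<=` approx n.+1 else approx n.+1 `<=` approx n.
  elim: n => [|n].
    by rewrite /approx /= /approx_step; case: isC => q; [left|case].
  by case: isC => IH; exact: approx_step_mono.
move/subnK <-; elim: (j - i) => [|k]; first by case: isC.
have := stepP (k + i); rewrite addSn; case: isC => h1 h2; first exact: subset_trans h2 h1.
exact: subset_trans h1 h2.
Qed.

(** In a monotone chain, stage [i.+1] is squeezed between stages [i] and [j]. *)
Lemma approx_stable i j : i < j -> approx i = approx j -> approx i.+1 = approx i.
Proof.
move=> ij eij; have := approx_mono (leqnSn i); have := approx_mono ij.
by rewrite -eij; case: isC => h1 h2; apply/seteqP.
Qed.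

Lemma approx_inj n :
  (forall m, m.+1 = n -> approx n <> approx m) ->
  injective (fun i : 'I_n.+1 => approx i).
Proof. by apply: iter_inj_before => i j; exact: approx_stable. Qed.

Lemma step_outcome_image q (x : step_choice A isV q) :
  step_outcome x `<=` [set outcome a | a in [set: profile q]].
Proof.
case: isV x => /= x q' [b ->]; first by exists (combine x b).
by exists (combine b (x b)).
Qed.

End Approximants.

(** * Fixed points from image-finiteness *)

Section ImageFinite.
Variables (M : cgm) (M_fin : image_finite M).
Variables (A : {set 'I_(num_agents M)}) (isV : bool) (X Y : set (state M)).

(** The finitely many outcomes of the move all lie in a common stage [n], which puts [q] into stage
    [n.+1]. *)
Lemma approx_cup_fixpoint q :
  (X q \/ Y q /\ pre A isV [set q' | exists n, approx A isV true X Y n q'] q) ->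
  exists n, approx A isV true X Y n q.
Proof.
move=> [Xq|[Yq [x xP]]]; first by exists 0.
have [n nP] := finite_chain_bound (M_fin q) (@approx_mono M A isV true X Y).
exists n.+1; right; split=> //; exists x => q' xq'.
by apply: nP; [exact: step_outcome_image xq' | exact: xP].
Qed.

Lemma approx_cap_fixpoint q :
  (forall n, approx A isV false X Y n q) ->
  X q /\ (Y q \/ pre A isV [set q' | forall n, approx A isV false X Y n q'] q).
Proof.
move=> Tq; split; first exact: Tq 0.
have [Yq|nY] := pselect (Y q); [by left|right].
have [|n nP] := finite_chain_bound (Z := fun n => ~` approx A isV false X Y n) (M_fin q).
  by move=> i j ij; apply: subsetC; exact: (@approx_mono M A isV false X Y).
(* By the choice of [n], a successor that leaves the chain at any stage has left it by stage [n].
   Hence a move that stays in stage [n] stays in all stages. *)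
have [_ [//|[x xP]]] := Tq n.+1.
exists x => q' xq' i; apply: contrapT => nTi.
apply: (nP q') (xP _ xq'); first exact: step_outcome_image xq'.
by exists i.
Qed.

End ImageFinite.

(** * Embedded games won exactly on the stages *)

Section EmbeddedWins.
Variables (M : cgm) (M_fin : image_finite M) (G : ordinal_type).
Variables (A : {set 'I_(num_agents M)}).

Definition embedded_wins (isV isC : bool) (X Y : set (state M)) : set (state M) :=
  [set q | exists s : embedded_strategy G A isV isC, forall e,
     embedded_exit s q e -> if e.2 then X e.1 else Y e.1].

(** Met by [omega], which contains every finite ordinal, and by the cardinal 2^kappa, by
    counting. *)
Hypothesis G_large : forall (n : nat) (f : 'I_n.+1 -> set (state M)),
  injective f -> exists g : G, is_nat n g.

(** Well-founded induction on the time limit of reachable configurations. Infinite limits are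
    harmless because the union of the stages is a fixed point. *)
Lemma controller_win_approx isV X Y q :
  embedded_wins isV true X Y q -> exists n, approx A isV true X Y n q.
Proof.
move=> [s sP].
have exitP g q' b : clos_refl_trans _ (config_move s (initial_limit s))
    (initial_limit s, q) (g, q') -> config_exit s (initial_limit s) (g, q') b ->
    if b then X q' else Y q'.
  move=> reach ex; apply: (sP (q', b)); exists (initial_limit s) => //.
  by exists g.
suff H g q' : clos_refl_trans _ (config_move s (initial_limit s))
    (initial_limit s, q) (g, q') -> exists n, approx A isV true X Y n q'.
  exact: H (rt_refl _ _ _).
elim/(well_founded_ind (@olt_wf G)): g q' => g IH q' reach.
apply: (approx_cup_fixpoint M_fin).
have [g0|ng0] := pselect (is_zero g).
  by left; apply: (exitP _ _ true reach); exact: ExitZero.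
case E : (controller_config s g q') => [x|]; last first.
  by left; apply: (exitP _ _ true reach); exact: (ExitSelf (isC := true)).
right; split.
  by apply: (exitP _ _ false reach); apply: (ExitOpp (isC := true)) => //= _; rewrite E.
exists x => q2 xq2.
have [g' g'g next] : exists2 g', olt g' g & possible_next_limit s g q2 g'.
  case: (nonzero_cases ng0) => [[g' sg']|lg].
    by exists g'; [case: sg' | left].
  by exists (timer s g q2); [exact: timer_lt | right].
apply: (IH g' g'g); apply: rt_trans reach _; apply: rt_step.
exact: (ConfigStep (x := x)).
Qed.

Lemma approx_controller_win isV X Y n (g : G) q :
  is_nat n g -> approx A isV true X Y n q -> embedded_wins isV true X Y q.
Proof.
move=> ng Tq; have [t tP] := default_timer (state M) g.
(* Invariant of play: the state lies in the stage numbered by the remaining time. *)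
pose B (h : G) q' := exists2 m, is_nat m h & approx A isV true X Y m q'.
have cE h q' : exists c : option (step_choice A isV q'), B h q' -> ~ is_zero h ->
    if c is Some x then Y q' /\ forall h' q2, is_succ_of h' h -> step_outcome x q2 -> B h' q2
    else X q'.
  have [Xq|nX] := pselect (X q'); first by exists None.
  have [[[|m] mh Tm]|nB] := pselect (B h q'); [by [] | | by exists None].
  case: Tm => [//|[Yq [x xP]]]; exists (Some x) => _ _; split=> // h' q2 h'h xq2.
  inversion mh as [|k h2 ? kh2 h2h]; subst.
  by rewrite (is_succ_of_fun h'h h2h); exists m => //; exact: xP.
pose c h q' := sval (cid (cE h q')).
have cP h q' : B h q' -> ~ is_zero h ->
    if c h q' is Some x then
      Y q' /\ forall h' q2, is_succ_of h' h -> step_outcome x q2 -> B h' q2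
    else X q' by exact: (svalP (cid (cE h q'))).
pose s : embedded_strategy G A isV true := ControllerStrategy g tP c.
exists s => -[q' b] /= [_ ->] [h reach ex].
have Bh : B h q'.
  suff reachB x y : clos_refl_trans _ (config_move s g) x y -> B x.1 x.2 -> B y.1 y.2.
    by apply: (reachB _ _ reach); exists n.
  elim=> // [_ _ [h1 q1 z q2 h2 nh1 cz zq2 nxt] /= B1|x1 y1 z _ IH1 _ IH2 /IH1 //].
  have := cP _ _ B1 nh1; rewrite /= in cz; rewrite cz => -[_]; apply=> //.
  (* The remaining time is finite, hence never a limit ordinal, so the timer is not consulted. *)
  case: nxt => // -[[_ nsucc] _]; case: B1 => [[|m] mh1 _].
    by inversion mh1.
  by inversion mh1 as [|k h3 ? _ h3h1]; subst; case: nsucc; exists h3.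
rewrite /= in ex; inversion ex as [h1 q1 h0|h1 q1 nh0 cN|h1 q1 nh0 cS]; subst.
- case: Bh => -[|m] mh Tm; first exact: Tm.
  by inversion mh as [|k h2 ? _ [h2h _]]; case: (h0 h2).
- by have := cP _ _ Bh nh0; rewrite /= in cN; rewrite cN.
- have := cP _ _ Bh nh0; have := cS isT; rewrite /=.
  by case: (c h q') => // x _ [].
Qed.

(** The opponent may open with the finite limit [g]; the strategy's answers then show, by induction
    on the remaining time, that each reached state lies in the matching stage. *)
Lemma noncontroller_win_approx isV X Y n (g : G) q :
  is_nat n g -> embedded_wins isV false X Y q -> approx A isV false X Y n q.
Proof.
move=> ng [s sP].
have exitP h q' b : clos_refl_trans _ (config_move s g) (g, q) (h, q') ->
    config_exit s g (h, q') b -> if b then X q' else Y q'.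
  by move=> reach ex; apply: (sP (q', b)); exists g => //; exists h.
suff H m h q' : is_nat m h -> clos_refl_trans _ (config_move s g) (g, q) (h, q') ->
    approx A isV false X Y m q'.
  by apply: H ng _; exact: rt_refl.
elim: m h q' => [|m IH] h q' mh reach; inversion mh as [? h0|k h2 ? kh2 h2h]; subst.
  by apply: (exitP _ _ true reach); exact: ExitZero.
have nh0 : ~ is_zero h by move=> /(_ h2); case: h2h.
split; first by apply: (exitP _ _ true reach); exact: (ExitOpp (isC := false)).
case E : (s g h q') => [x|]; last first.
  by left; apply: (exitP _ _ false reach); exact: (ExitSelf (isC := false)).
right; exists x => q2 xq2; apply: (IH h2) => //.
apply: rt_trans reach _; apply: rt_step.
by apply: (ConfigStep (x := x)) => //; left.
Qed.

(** As the intersection of the stages is a fixed point, a strategy that ignores time limits can stay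
    inside it until it exits into [Y]; exits of the opponent fall into stage 0, which is [X]. *)
Lemma approx_noncontroller_win isV X Y q :
  (forall n, approx A isV false X Y n q) -> embedded_wins isV false X Y q.
Proof.
pose B q' := forall n, approx A isV false X Y n q'.
have cE q' : exists c : option (step_choice A isV q'), B q' ->
    if c is Some x then step_outcome x `<=` B else Y q'.
  have [Bq|nB] := pselect (B q'); last by exists None.
  have [_ [Yq|[x xP]]] := approx_cap_fixpoint M_fin Bq; first by exists None.
  by exists (Some x).
pose c q' := sval (cid (cE q')).
have cP q' : B q' -> if c q' is Some x then step_outcome x `<=` B else Y q'
  by exact: (svalP (cid (cE q'))).
move=> Bq; pose s : embedded_strategy G A isV false := fun _ _ => c.
exists s => -[q' b] /= [g _] [h reach ex].
have Bh : B q'.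
  suff reachB x y : clos_refl_trans _ (config_move s g) x y -> B x.2 -> B y.2.
    exact: (reachB _ _ reach).
  elim=> // [_ _ [h1 q1 z q2 h2 nh1 cz zq2 nxt] /= B1|x1 y1 z _ IH1 _ IH2 /IH1 //].
  by have := cP _ B1; rewrite /= /s in cz; rewrite cz; apply.
rewrite /= in ex; inversion ex as [h1 q1 h0|h1 q1 nh0 cN|h1 q1 nh0 _]; subst.
- exact: Bh 0.
- by have := cP _ Bh; rewrite /= /s in cN; rewrite cN.
- exact: Bh 0.
Qed.

Lemma new_stage_is_nat isV isC X Y n :
  (forall m, m.+1 = n -> approx A isV isC X Y n <> approx A isV isC X Y m) ->
  exists g : G, is_nat n g.
Proof. by move=> new; apply: G_large; exact: approx_inj new. Qed.

Lemma embedded_winsE isV isC X Y q : embedded_wins isV isC X Y q <->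
  if isC then exists n, approx A isV isC X Y n q
  else forall n, approx A isV isC X Y n q.
Proof.
case: isC; split.
- exact: controller_win_approx.
- move=> [m Tm]; have ex : exists m, `[< approx A isV true X Y m q >].
    by exists m; apply/asboolP.
  (* The least stage containing [q] differs from the one before it, so its index is available as a
     time limit in [G]. *)
  case: (ex_minnP ex) => n /asboolP Tn nmin.
  have [|g ng] := @new_stage_is_nat isV true X Y n.
    move=> k kn enk; suff : n <= k by rewrite -kn ltnn.
    by apply: nmin; apply/asboolP; rewrite -enk.
  exact: approx_controller_win ng Tn.
- move=> Wq m; apply: contrapT => nTm.
  have ex : exists m, `[< ~ approx A isV false X Y m q >].
    by exists m; apply/asboolP.
  (* Dually, the first stage that omits [q] is new, and the opponent can open with its index. *)
  case: (ex_minnP ex) => n /asboolP Tn nmin.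
  have [|g ng] := @new_stage_is_nat isV false X Y n.
    move=> k kn enk; suff : n <= k by rewrite -kn ltnn.
    by apply: nmin; apply/asboolP; rewrite -enk.
  exact: Tn (noncontroller_win_approx ng Wq).
- exact: approx_noncontroller_win.
Qed.

End EmbeddedWins.

(** * Compositional winning sets *)

Section CompositionalWinning.
Variables (M : cgm) (G : ordinal_type).

(** The winner meant is always Eloise; [Q] is the player named in the position. *)
Fixpoint wins (phi : formula M) (Q : player) : set (state M) :=
  let b := same Eloise Q in
  match phi with
  | Symb p => [set q | wins_at Eloise Q q p]
  | Neg psi => wins psi (opp Q)
  | Or psi theta => if b then wins psi Q `|` wins theta Q else wins psi Q `&` wins theta Q
  | Next A psi => pre A b (wins psi Q)
  | Until A psi theta => embedded_wins G A b b (wins theta Q) (wins psi Q)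
  | Release A psi theta =>
      embedded_wins G A b (same Eloise (opp Q)) (wins theta Q) (wins psi Q)
  end.

Definition wins_pos (pos : position M) : Prop :=
  wins (pos_formula pos) (pos_player pos) (pos_state pos).

Lemma wins_choice pos :
  wins_pos pos -> exists c : choice_at G Eloise pos, next_positions c `<=` wins_pos.
Proof.
case: pos => Q q [p|psi|psi theta|B psi|B psi theta|B psi theta]; rewrite /wins_pos /=.
- by move=> _; exists tt.
- by move=> w; exists tt => _ ->.
- case: Q => [[w|w]|[w1 w2]].
  + by exists true => _ [_ -> <-].
  + by exists false => _ [_ -> <-].
  + by exists tt => _ [_ [->|->] <-].
- by move=> [x xP]; exists x => _ [q' /xP w <-].
- by move=> [s sP]; exists s => _ [[q' b] /sP /= w <-]; case: b w.
- by move=> [s sP]; exists s => _ [[q' b] /sP /= w <-]; case: b w.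
Qed.

(** Symbols are excluded because they have no next position, so the inclusion would hold vacuously
    there. *)
Lemma choice_wins pos (c : choice_at G Eloise pos) :
  (forall p, pos_formula pos <> Symb _ p) ->
  next_positions c `<=` wins_pos -> wins_pos pos.
Proof.
case: pos c => Q q [p|psi|psi theta|B psi|B psi theta|B psi theta];
  rewrite /wins_pos /= => c nS nxt.
- by case: (nS p).
- exact: (nxt (Position (opp Q) q psi)).
- move: c nxt; case: Q nS => nS c nxt.
    case: c nxt => nxt; [left|right].
      by apply: (nxt (Position Eloise q psi)); exists psi.
    by apply: (nxt (Position Eloise q theta)); exists theta.
  split; first by apply: (nxt (Position Abelard q psi)); exists psi => //; left.
  by apply: (nxt (Position Abelard q theta)); exists theta => //; right.
- by exists c => q' cq'; apply: (nxt (Position Q q' psi)); exists q'.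
- exists c => -[q' b] ex.
  have := nxt (Position Q q' (if b then theta else psi)).
  by case: b ex => ex; apply; [exists (q', true)|exists (q', false)].
- exists c => -[q' b] ex.
  have := nxt (Position Q q' (if b then theta else psi)).
  by case: b ex => ex; apply; [exists (q', true)|exists (q', false)].
Qed.

Lemma action_inhabited (A : {set 'I_(num_agents M)}) (q : state M) :
  inhabited (action A q).
Proof.
by constructor=> i _; have [a ai] := cid (avail_nonempty i q); exists a.
Qed.

Lemma step_choice_inhabited (A : {set 'I_(num_agents M)}) isV (q : state M) :
  inhabited (step_choice A isV q).
Proof.
have [a] := action_inhabited A q; have [b] := action_inhabited (~: A)%SET q.
by case: isV; constructor.
Qed.

Lemma embedded_strategy_inhabited (A : {set 'I_(num_agents M)}) isV isC :
  G -> inhabited (embedded_strategy G A isV isC).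
Proof.
move=> g; have [t tP] := default_timer (state M) g.
case: isC; last by constructor=> _ _ q; exact: None.
by constructor; apply: (ControllerStrategy g tP) => _ q; exact: None.
Qed.

(** A strategy prescribes something at lost positions too. The element of [G] provides the initial
    limit that a controller has to name. *)
Lemma choice_at_inhabited P (pos : position M) : G -> inhabited (choice_at G P pos).
Proof.
move=> g; case: pos => Q q [p|psi|psi theta|B psi|B psi theta|B psi theta] /=.
- by constructor; exact: tt.
- by constructor; exact: tt.
- by case: P Q => -[]; constructor; try exact: true; exact: tt.
- exact: step_choice_inhabited.
- exact: embedded_strategy_inhabited.
- exact: embedded_strategy_inhabited.
Qed.

Lemma Eloise_winsE (q : state M) (phi : formula M) :
  G -> Eloise_wins G q phi <-> wins phi Eloise q.
Proof.
move=> g; split.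
  move=> [sigma]; rewrite -[wins _ _ _]/(wins_pos (Position Eloise q phi)).
  (* A play from a next position extends to a play from [pos], so [sigma] remains winning and
     induction on the formula applies. *)
  have step (pos : position M) : winning sigma pos -> (forall p, pos_formula pos <> Symb _ p) ->
      (forall y, next_positions (sigma pos) y -> winning sigma y -> wins_pos y) -> wins_pos pos.
    move=> win nS IH; apply: (choice_wins (c := sigma pos)) => // y nxt.
    apply: IH => // Q1 q1 p1 py; apply: win; apply: rt_trans _ py.
    exact: rt_step.
  suff H chi Q q' : winning sigma (Position Q q' chi) ->
    wins_pos (Position Q q' chi) by exact: H.
  elim: chi Q q' => [p|psi IH|psi IH1 theta IH2|B psi IH|B psi IH1 theta IH2|B psi IH1 theta IH2]
    Q q' win; first by apply: (win Q q' p); exact: rt_refl.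
  + by apply: step => // y -> /IH.
  + apply: step => // y; move: (sigma _) => /=; case: Q {win} => c [chi].
      by move=> -> <-; case: c => [/IH1|/IH2].
    by move=> [->|->] <-; [move/IH1|move/IH2].
  + by apply: step => // _ [q2 _ <-] /IH.
  + by apply: step => // _ [[q2 [|]] _ <-]; [move/IH2|move/IH1].
  + by apply: step => // _ [[q2 [|]] _ <-]; [move/IH2|move/IH1].
move=> w.
(* Local choices that preserve [wins_pos] are glued into one strategy; at lost positions any choice
   will do. *)
have sE (pos : position M) : exists c : choice_at G Eloise pos, wins_pos pos -> next_positions c `<=` wins_pos.
  have [/wins_choice[c cP]|nw] := pselect (wins_pos pos); first by exists c.
  by have [c] := choice_at_inhabited Eloise pos g; exists c.
exists (fun pos => sval (cid (sE pos))) => Q q' p reach.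
rewrite -[wins_at _ _ _ _]/(wins_pos (Position Q q' (Symb _ p))).
have {w} : wins_pos (Position Eloise q phi) by [].
elim: reach => // [x y xy wx|x y z _ IH1 _ IH2 /IH1 //].
exact: (svalP (cid (sE x))) wx _ xy.
Qed.

End CompositionalWinning.

(** * Independence of the bound *)

Lemma wins_indep (M : cgm) (M_fin : image_finite M) (G G' : ordinal_type) :
  (forall (n : nat) (f : 'I_n.+1 -> set (state M)),
     injective f -> exists g : G, is_nat n g) ->
  (forall (n : nat) (f : 'I_n.+1 -> set (state M)),
     injective f -> exists g : G', is_nat n g) ->
  forall (phi : formula M) (Q : player), wins G phi Q = wins G' phi Q.
Proof.
move=> GL GL'.
(* Both sides are described by the same stages, whose definition does not mention the bound. *)
have embE (A : {set 'I_(num_agents M)}) isV isC X Y :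
    embedded_wins G A isV isC X Y = embedded_wins G' A isV isC X Y.
  apply/seteqP; split=> q.
    by move/(embedded_winsE M_fin A GL)/(embedded_winsE M_fin A GL').
  by move/(embedded_winsE M_fin A GL')/(embedded_winsE M_fin A GL).
elim=> [p|psi IH|psi IH1 theta IH2|B psi IH|B psi IH1 theta IH2|B psi IH1 theta IH2] Q //=;
  by rewrite ?IH ?IH1 ?IH2 ?embE.
Qed.

(** Equinumerosity turns [f] into an injection into the cardinal, to which the pigeonhole argument
    applies. *)
Lemma is_nat_cardinal (T : Type) (n : nat) (f : 'I_n.+1 -> T) :
  injective f -> exists g : cardinal T, is_nat n g.
Proof.
move=> finj; have [/card_eqPle[_ /card_leP[h]] _] := svalP (cid (cardinal_exists T)).
apply: (@is_nat_exists (cardinal T) n (fun i => val (h (to_setT (f i))))) => i j.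
move=> /val_inj hij; apply: finj.
have : to_setT (f i) = to_setT (f j) by apply: (inj (f := h)); rewrite ?inE.
by move=> /(congr1 val).
Qed.

Theorem theorem4p27 (M : cgm) (M_fin : image_finite M)
    (q : state M) (phi : formula M) :
  sat_finite q phi <-> sat_bounded q phi.
Proof.
(* A family indexed by the singleton ['I_1] is trivially injective; this yields the element of
   2^kappa that [Eloise_winsE] asks for. *)
have [g _] := @is_nat_cardinal (set (state M)) 0 (fun=> set0)
  (fun i j _ => etrans (ord1 i) (esym (ord1 j))).
rewrite /sat_finite /sat_bounded (Eloise_winsE _ _ (0 : omega)) (Eloise_winsE _ _ g).
rewrite (wins_indep M_fin (G := omega) (G' := cardinal (set (state M)))) //.
  by move=> n _ _; exists n; exact: is_nat_omega.
by move=> n f; exact: is_nat_cardinal.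
Qed.
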